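(* Let $G$ be a weak FI-group with a central filtration $\{G(k)\}_{k=1}^\infty$ of finite rank. If $G$ is boundedly generated, then for every $k\geq 1$ the normal weak FI-subgroup $G(k)\lhd G$ is boundedly normally generated.
   Context: $\mathrm{FI}$ is the category whose objects are finite subsets of $\mathbb{N}$ and whose morphisms are injections. For groups $A,B$, a homomorphism-modulo-conjugacy $A\to B$ is an equivalence class of homomorphisms $A\to B$ under post-composition with conjugation by elements of $B$; these compose. For finite $I\subset J\subset\mathbb{N}$, $i_I^J$ denotes the inclusion. A weak FI-group $G$ consists of: (i) a group $G_I$ for each finite $I\subset\mathbb{N}$; (ii) for each injection $f\colon I\hookrightarrow J$ a homomorphism-modulo-conjugacy $G_f\colon G_I\to G_J$ with $G_{\mathrm{id}_I}=\mathrm{id}$ and $G_{g\circ f}=G_g\circ G_f$ modulo conjugacy; (iii) for each pair $I\subset J$ an actual homomorphism $G_I^J\colon G_I\to G_J$ representing $G_{i_I^J}$, with $G_J^K\circ G_I^J=G_I^K$ for $I\subset J\subset K$. A normal weak FI-subgroup $H\lhd G$ is a choice of normal subgroup $H_I\lhd G_I$ for each $I$ such that $G_f(H_I)\subset H_J$ for every injection $f\colon I\hookrightarrow J$ (well defined since $H_I$ is normal). For $I\subset J$ and $H\lhd G$ set $H_J(I)=G_I^J(H_I)\subset H_J$. $G$ is boundedly generated (in degree $A$) if for every finite $J$, $G_J$ is generated by the subgroups $G_J(I)$ with $I\subset J$, $|I|\leq A$. $H\lhd G$ is boundedly normally generated (in degree $B$) if for every finite $J$, $H_J$ is generated by the $G_J$-conjugates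 of the subgroups $H_J(I)$ with $I\subset J$, $|I|\leq B$. A central filtration of $G$ is a sequence of normal weak FI-subgroups $G=G(1)\supset G(2)\supset\cdots$ (inclusions meaning $G(k+1)_I\subset G(k)_I$ for all $I$) with $[G_I,G(k)_I]\subset G(k+1)_I$ for all $k$ and $I$; it has finite rank if each abelian group $G(k)_I/G(k+1)_I$ is finitely generated. *)

(* Defs.v *)
(* Abstract (possibly infinite) groups are
   given explicitly as a record, since MathComp only has finite groups. *)
From mathcomp Require Import all_boot.
From mathcomp Require Import finmap.
From Stdlib Require List.

Set Implicit Arguments.
Unset Strict Implicit.
Unset Printing Implicit Defensive.

Local Open Scope fset_scope.

Record group := Group {
  carrier :> Type;
  gmul : carrier -> carrier -> carrier;
  ginv : carrier -> carrier;
  gone : carrier;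
  gmulA : forall x y z, gmul x (gmul y z) = gmul (gmul x y) z;
  gmul1 : forall x, gmul gone x = x;
  gmulV : forall x, gmul (ginv x) x = gone
}.

Arguments gmul {g}.
Arguments ginv {g}.
Arguments gone {g}.

Definition gconj (A : group) (x g : A) : A := gmul (ginv g) (gmul x g).
Definition gcomm (A : group) (x y : A) : A :=
  gmul (ginv x) (gmul (ginv y) (gmul x y)).

Definition is_hom (A B : group) (f : A -> B) : Prop :=
  forall x y, f (gmul x y) = gmul (f x) (f y).

(* f and g agree up to post-composition with a conjugation of B,
   i.e. they represent the same homomorphism-modulo-conjugacy *)
Definition conj_equiv (A B : group) (f g : A -> B) : Prop :=
  exists b : B, forall x, g x = gconj (f x) b.

Definition is_subgroup (A : group) (H : A -> Prop) : Prop :=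
  [/\ H gone, (forall x y, H x -> H y -> H (gmul x y)) & (forall x, H x -> H (ginv x))].

Definition is_normal_subgroup (A : group) (H : A -> Prop) : Prop :=
  is_subgroup H /\ forall x g, H x -> H (gconj x g).

Inductive gen (A : group) (S : A -> Prop) : A -> Prop :=
  | gen_base x : S x -> gen S x
  | gen_one : gen S gone
  | gen_mul x y : gen S x -> gen S y -> gen S (gmul x y)
  | gen_inv x : gen S x -> gen S (ginv x).

(* a morphism I -> J of FI, represented by any function nat -> nat whose
   restriction to I is injective with values in J *)
Definition FI_map (I J : {fset nat}) (f : nat -> nat) : Prop :=
  {in I &, injective f} /\ forall x, x \in I -> f x \in J.

Unset Implicit Arguments.
Record weakFIgroup := WeakFIgroup {
  Gobj : {fset nat} -> group;
  (* a representative of G_f, for f an injection I -> J *)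
  Gmap : forall I J : {fset nat}, (nat -> nat) -> Gobj I -> Gobj J;
  (* G_I^J, meaningful for I \subset J *)
  Ginc : forall I J : {fset nat}, Gobj I -> Gobj J;
  Gmap_hom : forall I J f, FI_map I J f -> is_hom (Gmap I J f);
  (* G_f depends only on the FI-morphism (restriction of f to I) *)
  Gmap_ext : forall I J f g, FI_map I J f -> {in I, f =1 g} ->
     conj_equiv (Gmap I J f) (Gmap I J g);
  Gmap_id : forall I, conj_equiv (Gmap I I id) id;
  Gmap_comp : forall I J K f g, FI_map I J f -> FI_map J K g ->
     conj_equiv (Gmap I K (g \o f)) (Gmap J K g \o Gmap I J f);
  Ginc_hom : forall I J, fsubset I J -> is_hom (Ginc I J);
  Ginc_rep : forall I J, fsubset I J -> conj_equiv (Gmap I J id) (Ginc I J);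
  Ginc_trans : forall I J K, fsubset I J -> fsubset J K ->
     Ginc J K \o Ginc I J =1 Ginc I K
}.

Set Implicit Arguments.
Arguments Gmap G I J f x : rename.
Arguments Ginc G I J x : rename.
Coercion Gobj : weakFIgroup >-> Funclass.

Definition FIsubset (G : weakFIgroup) := forall I : {fset nat}, G I -> Prop.

Definition normal_weakFIsubgroup (G : weakFIgroup) (H : FIsubset G) : Prop :=
  (forall I, is_normal_subgroup (H I)) /\
  (forall I J f, FI_map I J f -> forall x, H I x -> H J (Gmap G I J f x)).

Definition sub_at (G : weakFIgroup) (H : FIsubset G) (I J : {fset nat})
  : G J -> Prop := fun y => exists2 x, H I x & y = Ginc G I J x.
Arguments sub_at {G} H I J _.

Definition boundedly_generated_in (G : weakFIgroup) (A : nat) : Prop :=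
  forall J : {fset nat}, forall x : G J,
    gen (fun y => exists2 I : {fset nat}, fsubset I J /\ #|` I| <= A &
                   @sub_at G (fun I0 (_ : G I0) => True) I J y) x.

Definition boundedly_generated (G : weakFIgroup) : Prop :=
  exists A, boundedly_generated_in G A.

Definition boundedly_normally_generated_in (G : weakFIgroup) (H : FIsubset G)
  (B : nat) : Prop :=
  forall J : {fset nat}, forall x : G J,
    H J x <->
    gen (fun y => exists2 I : {fset nat}, fsubset I J /\ #|` I| <= B &
           exists2 z, sub_at H I J z & exists g : G J, y = gconj z g) x.

Definition boundedly_normally_generated (G : weakFIgroup) (H : FIsubset G) : Prop :=
  exists B, boundedly_normally_generated_in H B.

(* central filtration G = G(1) ⊃ G(2) ⊃ ... ; indices k >= 1 (Gf 0 unused) *)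
Definition central_filtration (G : weakFIgroup) (Gf : nat -> FIsubset G) : Prop :=
  [/\ (forall k, 1 <= k -> normal_weakFIsubgroup (Gf k)),
      (forall I (x : G I), Gf 1 I x),
      (forall k, 1 <= k -> forall I (x : G I), Gf k.+1 I x -> Gf k I x) &
      (forall k, 1 <= k -> forall I (x : G I),
          gen (fun c => exists g h, Gf k I h /\ c = gcomm g h) x -> Gf k.+1 I x)].

(* G(k)_I / G(k+1)_I is finitely generated: there is a finite list s of
   elements of G(k)_I whose cosets generate the quotient, i.e. every coset
   x G(k+1)_I (x in G(k)_I) equals y G(k+1)_I for some y in <s>. *)
Definition finite_rank (G : weakFIgroup) (Gf : nat -> FIsubset G) : Prop :=
  forall k, 1 <= k -> forall I : {fset nat},
    exists s : seq (G I),
      (forall a, List.In a s -> Gf k I a) /\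
      forall x, Gf k I x ->
        exists2 y, gen (fun a => List.In a s) y & Gf k.+1 I (gmul (ginv y) x).

(* Main.v *)
(* By induction on k, suppose that G(k) is boundedly normally generated. Then
   M_J = G(k)_J / G(k+1)_J, on which conjugation acts trivially, is generated by
   the images of finitely many elements v_(b,j) of G(k)_{0..b-1} under the
   increasing injections {0..b-1} -> J, b bounded. A Groebner basis argument
   shows that the integral relations between these images are all induced from
   relations of some bounded degree N. Let D_J be the normal closure in G_J of
   the G(k+1)_J(I) with |I| <= N, where N also exceeds the sum of the degrees of
   generation of G and G(k). Then G(k)_J / D_J is central in G_J / D_J, because
   generators of G_J and G(k)_J already commute modulo G(k+1) over a set of size
   at most N. It is therefore an abelian group with the same generators as M_J,
   in which the relations of degree at most N hold, hence all relations of M_J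
   hold; so D_J = G(k+1)_J. *)
Require Import Defs.
From HB Require Import structures.
From mathcomp Require Import all_boot all_order all_algebra.
From mathcomp Require Import finmap boolp zify.
Set Implicit Arguments.
Unset Strict Implicit.
Unset Printing Implicit Defensive.
Import GRing.Theory.

(** * Well-quasi-orderings of words and monomials *)

Lemma nondecreasing_subsequence (x : nat -> nat) :
  exists2 f : nat -> nat, {homo f : i j / i < j} & {homo x \o f : i j / i <= j}.
Proof.
(* Every tail of [x] attains its minimum; [f] jumps from one tail minimum to the next. *)
have min_after s : exists i, s <= i /\ forall j, s <= j -> x i <= x j.
  suff H v : forall i, s <= i -> x i <= v ->
      exists i, s <= i /\ forall j, s <= j -> x i <= x j by exact: (H (x s) s).
  elim: v => [|v IH] i si xi; first by exists i; split=> // j _; lia.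
  have [/asboolP[j [sj xj]]|/asboolPn no] :=
    boolP `[< exists j, s <= j /\ x j <= v >]; first exact: IH j sj xj.
  exists i; split=> // j sj; rewrite leqNgt; apply/negP => lt; apply: no.
  by exists j; split=> //; lia.
have [m mP] := choice min_after.
pose f n := iter n (fun i => m i.+1) (m 0).
have f_lt i : f i < f i.+1 by have [] := mP (f i).+1.
have x_le i : x (f i) <= x (f i.+1).
  case: i => [|i]; first by have [_] := mP 0; apply.
  have [_ H] := mP (f i).+1; apply: (H (m (m (f i).+1).+1)).
  by have := f_lt i; have := f_lt i.+1; rewrite /=; lia.
exists f; first exact: (homo_ltn ltn_trans).
exact: (homo_leq leqnn leq_trans).
Qed.

(* A word w of length n with b ones stands for a b-element subset of an n-element
   totally ordered set, i.e. an increasing injection from {0..b-1}; [ins m w] is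
   its image under the increasing injection whose image is the set of ones of m. *)
Fixpoint ins (m w : bitseq) : bitseq :=
  match m, w with
  | true :: m', x :: w' => x :: ins m' w'
  | _ :: m', _ => false :: ins m' w
  | [::], _ => [::]
  end.

Lemma size_ins m w : size (ins m w) = size m.
Proof. by elim: m w => [|[] m IH] [|x w] //=; rewrite IH. Qed.

Lemma count_ins m w : count id m = size w -> count id (ins m w) = count id w.
Proof.
elim: m w => [|[] m IH] w /=; first by case: w.
  by case: w => [|x w] //= [/IH ->].
by rewrite add0n => /IH; case: w => [|x w] /= ->.
Qed.

Lemma mask_ins (A : Type) m w (s : seq A) :
  count id m = size w -> mask (ins m w) s = mask w (mask m s).
Proof.
elim: m w s => [|b m IH] w s; first by case: w.
case: s => [|y s]; first by rewrite !mask0.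
case: b => /=; last by rewrite add0n => /IH; case: w => [|x w]/= ->.
by case: w => [|x w] //= [/IH ->].
Qed.

Lemma ins_cat m1 m2 u1 u2 : count id m1 = size u1 ->
  ins (m1 ++ m2) (u1 ++ u2) = ins m1 u1 ++ ins m2 u2.
Proof.
elim: m1 u1 => [|[] m1 IH] u1 /=; first by case: u1.
  by case: u1 => [|x u1] //= [/IH ->].
by rewrite add0n => /IH; case: u1 => [|x u1] /= ->.
Qed.

(** Divisibility of monomials: [v] arises from [u] by inserting zeros where [m] is zero. *)
Definition embeds (u v : bitseq) := exists2 m, count id m = size u & v = ins m u.

Lemma embeds_cat u1 v1 u2 v2 :
  embeds u1 v1 -> embeds u2 v2 -> embeds (u1 ++ u2) (v1 ++ v2).
Proof.
move=> [m1 c1 ->] [m2 c2 ->]; exists (m1 ++ m2); last by rewrite ins_cat.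
by rewrite count_cat size_cat c1 c2.
Qed.

Lemma embeds_zeros g h : g <= h -> embeds (nseq g false) (nseq h false).
Proof.
move=> gh; exists (nseq g true ++ nseq (h - g) false).
  by rewrite count_cat !count_nseq size_nseq /= mul1n addn0.
elim: g h gh => [|g IH] h gh; last by case: h gh => //= h gh; rewrite -IH.
by rewrite subn0 /=; elim: h {gh} => //= h <-.
Qed.

Lemma split_first_one w : has id w ->
  exists g u, w = nseq g false ++ true :: u.
Proof.
elim: w => //= -[] w IH; first by exists 0, w.
by case/IH => g [u ->]; exists g.+1, u.
Qed.

Lemma homo_comp_lt (f h : nat -> nat) :
  {homo f : i j / i < j} -> {homo h : i j / i < j} ->
  {homo f \o h : i j / i < j}.
Proof. by move=> fm hm i j /hm /fm. Qed.

Lemma homo_lt_le (f : nat -> nat) :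
  {homo f : i j / i < j} -> {homo f : i j / i <= j}.
Proof. by move=> fm i j; rewrite leq_eqVlt => /orP[/eqP->//|/fm/ltnW]. Qed.

(** Split a word at its first one. The numbers of leading zeros can be made nondecreasing, the
    remainders have one fewer one and are handled by induction, and embeddings concatenate. *)
Lemma embeds_subsequence b (x : nat -> bitseq) :
  (forall n, count id (x n) = b) ->
  exists2 f : nat -> nat, {homo f : i j / i < j} &
    forall i j, i <= j -> embeds (x (f i)) (x (f j)).
Proof.
elim: b x => [|b IH] x cx.
  have xE n : x n = nseq (size (x n)) false.
    move/eqP: (cx n); rewrite -leqn0 leqNgt -has_count.
    by elim: (x n) => //= -[] //= w IHw /IHw <-.
  have [f fm fx] := nondecreasing_subsequence (size \o x).
  by exists f => // i j ij; rewrite xE (xE (f j)); apply/embeds_zeros/fx.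
have xE n : exists gu : nat * bitseq, x n = nseq gu.1 false ++ true :: gu.2.
  have /split_first_one[g [u ->]] : has id (x n) by rewrite has_count cx.
  by exists (g, u).
have [gu guP] := choice xE.
have [f fm fx] := nondecreasing_subsequence (fst \o gu).
have [n|h hm hx] := IH (fun n => (gu (f n)).2).
  by move: (cx (f n)); rewrite guP count_cat count_nseq /= mul0n => -[].
exists (f \o h); first exact: homo_comp_lt.
move=> i j ij /=; rewrite !guP; apply: embeds_cat.
  by apply/embeds_zeros/fx/homo_lt_le.
by apply: (@embeds_cat [:: true] [:: true]); [exists [:: true]|apply: hx].
Qed.

(* The number of ones and the label are made constant along a subsequence by
   making both the quantity and its complement nondecreasing. *)
Lemma monomial_subsequence B R (x : nat -> bitseq * 'I_R * nat) :
  (forall n, count id (x n).1.1 <= B) ->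
  exists2 f : nat -> nat, {homo f : i j / i < j} &
    forall i j, i <= j -> [/\ embeds (x (f i)).1.1 (x (f j)).1.1,
      (x (f i)).1.2 = (x (f j)).1.2 & (x (f i)).2 <= (x (f j)).2].
Proof.
move=> cB.
have [f1 m1 x1] := nondecreasing_subsequence (fun n => count id (x n).1.1).
have [f2 m2 x2] := nondecreasing_subsequence (fun n => B - count id (x (f1 n)).1.1).
have [f3 m3 x3] := nondecreasing_subsequence (fun n => (x (f1 (f2 n))).1.2 : nat).
have [f4 m4 x4] := nondecreasing_subsequence (fun n => R - (x (f1 (f2 (f3 n)))).1.2).
have [f5 m5 x5] := nondecreasing_subsequence (fun n => (x (f1 (f2 (f3 (f4 n))))).2).
pose f := f1 \o (f2 \o (f3 \o (f4 \o f5))).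
have [n|h hm hx] := @embeds_subsequence (count id (x (f 0)).1.1) (fun n => (x (f n)).1.1).
  have le0 : f3 (f4 (f5 0)) <= f3 (f4 (f5 n)).
    by do 3![apply: homo_lt_le => //].
  have /= le2 := x2 _ _ le0; have := x1 _ _ (homo_lt_le m2 le0); rewrite /=.
  by have := cB (f n); have := cB (f 0); rewrite /f/= in le2 *; lia.
exists (f \o h); first by do 5![apply: homo_comp_lt => //].
move=> i j ij; have lij := homo_lt_le hm ij; split; first exact: hx.
  apply: ord_inj; have le5 := homo_lt_le m5 lij; have /= := x4 _ _ le5.
  have /= := x3 _ _ (homo_lt_le m4 le5); rewrite /f /=.
  case: (x _).1.2 => a aR; case: (x _).1.2 => c cR /=; lia.
exact: x5.
Qed.

(** Dickson's lemma: otherwise every [N] has a counterexample [x N], and two members of a good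
    subsequence of these contradict the choice of the later one. *)
Lemma monomials_finitely_dominated B R (L : bitseq * 'I_R * nat -> Prop) :
  (forall x, L x -> count id x.1.1 <= B) ->
  exists N, forall x, L x -> exists y, [/\ L y, size y.1.1 <= N,
    embeds y.1.1 x.1.1, y.1.2 = x.1.2 & y.2 <= x.2].
Proof.
move=> LB; apply: contrapT => /forallNP no.
have bad N : exists x, L x /\ forall y, L y -> size y.1.1 <= N ->
    embeds y.1.1 x.1.1 -> y.1.2 = x.1.2 -> ~ y.2 <= x.2.
  have /existsNP[x /not_implyP[Lx nx]] := no N.
  by exists x; split=> // y Ly sy ey jy cy; apply: nx; exists y.
have [x xP] := choice bad.
have [n|f fm fx] := @monomial_subsequence B R x; first exact/LB/(proj1 (xP n)).
(* As [f s] is at least [s], the first term is short enough to be among those that [x (f s)] was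
   chosen to avoid. *)
set s := size (x (f 0)).1.1.
have sf i : i <= f i by elim: i => // i IH; exact: leq_ltn_trans IH (fm _ _ _).
have [e j c] := fx 0 s (leq0n s).
by case: (xP (f s)) => _ /(_ (x (f 0)) (proj1 (xP _)) (sf s) e j); apply.
Qed.

(** * A total order on words, compatible with insertion *)

(** The binary value, which orders words of equal length lexicographically. *)
Fixpoint num (w : bitseq) : nat :=
  if w is x :: w' then x * 2 ^ size w' + num w' else 0.

Lemma num_lt w : num w < 2 ^ size w.
Proof. by elim: w => //= -[] w IH; rewrite expnS; lia. Qed.

Lemma num_inj u v : size u = size v -> num u = num v -> u = v.
Proof.
elim: u v => [|x u IH] [|y v] //= [s] E.
have := num_lt u; have := num_lt v; rewrite -s.
by move: x y E => [] []; rewrite -?s => E lt1 lt2; first [lia | congr cons; apply: IH; lia].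
Qed.

(** Both words receive zeros at the same places, so their first difference keeps its direction. *)
Lemma num_ins m u v : count id m = size u -> count id m = size v ->
  num u <= num v -> num (ins m u) <= num (ins m v).
Proof.
elim: m u v => [|b m IH] u v; first by case: u; case: v.
case: b => /=; last first.
  rewrite !size_ins => su sv /(IH _ _ su sv).
  by case: u v {su sv} => [|x u] [|y v] /=; rewrite ?size_ins ?mul0n.
case: u v => [|x u] [|y v] //= [su] [sv]; rewrite !size_ins.
have := num_lt u; have := num_lt v; rewrite -su -sv.
have := num_lt (ins m u); have := num_lt (ins m v); rewrite !size_ins.
have := IH u v su sv.
by move: x y => [] [] H a b c d /=; lia.
Qed.

Lemma ins_inj m u v : count id m = size u -> count id m = size v ->
  ins m u = ins m v -> u = v.
Proof.
move=> su sv E.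
have K w : count id m = size w -> mask m (ins m w) = w.
  elim: (m) w => [|[] m' IH] w /=; first by case: w.
    by case: w => //= x w [/IH ->].
  by rewrite add0n => /IH; case: w => [|x w] /= ->.
by rewrite -(K u su) E K.
Qed.

(** * Integral relations between monomials *)

Section Relations.
Variables (B R : nat).
Local Notation monomial := (bitseq * 'I_R)%type.
Local Notation combination := (seq (monomial * int)).

(** The monomial order: words are compared first, and labels, being below [R], break ties. *)
Definition rank (t : monomial) := num t.1 * R + t.2.
Definition push_mon (m : bitseq) (t : monomial) : monomial := (ins m t.1, t.2).

Lemma rank_inj (t t' : monomial) :
  size t.1 = size t'.1 -> rank t = rank t' -> t = t'.
Proof.
move: t t' => [u [i iR]] [v [j jR]] /= s; rewrite /rank /= => E.
have En : num u = num v by nia.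
rewrite (num_inj s En); congr (_, _); apply: ord_inj => /=; lia.
Qed.

Lemma rank_push m (t t' : monomial) :
  count id m = size t.1 -> count id m = size t'.1 ->
  rank t <= rank t' -> rank (push_mon m t) <= rank (push_mon m t').
Proof.
move: t t' => [u [i iR]] [v [j jR]] /= su sv; rewrite /rank /= => E.
have le : num u <= num v by nia.
have := num_ins su sv le; rewrite leq_eqVlt => /orP[/eqP e|]; last by nia.
have uv : u = v by apply: (ins_inj su sv); apply: num_inj e; rewrite !size_ins.
by move: E; rewrite uv; lia.
Qed.

Definition coef (p : combination) t : int := (\sum_(x <- p | x.1 == t) x.2)%R.
Definition opp (p : combination) : combination := [seq (x.1, - x.2)%R | x <- p].
Definition push m (p : combination) : combination :=
  [seq (push_mon m x.1, x.2) | x <- p].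
Definition ev (V : zmodType) (e : monomial -> V) (p : combination) : V :=
  (\sum_(x <- p) e x.1 *~ x.2)%R.
Definition homogeneous n (p : combination) :=
  all (fun x => (size x.1.1 == n) && (count id x.1.1 <= B)) p.

Lemma coef_cat p q t : coef (p ++ q) t = (coef p t + coef q t)%R.
Proof. by rewrite /coef big_cat. Qed.

Lemma coef_opp p t : coef (opp p) t = (- coef p t)%R.
Proof. by rewrite /coef big_map sumrN. Qed.

Lemma ev_cat (V : zmodType) (e : monomial -> V) p q :
  ev e (p ++ q) = (ev e p + ev e q)%R.
Proof. by rewrite /ev big_cat. Qed.

Lemma ev_opp (V : zmodType) (e : monomial -> V) p : ev e (opp p) = (- ev e p)%R.
Proof. by rewrite /ev big_map -sumrN; apply: eq_bigr => x _; rewrite mulrNz. Qed.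

(** Collecting equal monomials shows that evaluation sees only total coefficients, so lists with
    repetitions may stand for formal sums. *)
Lemma ev_coef0 (V : zmodType) (e : monomial -> V) p :
  (forall t, coef p t = 0%R) -> ev e p = 0%R.
Proof.
move=> p0; pose s := undup [seq x.1 | x <- p].
have -> : ev e p = (\sum_(x <- p) \sum_(t <- s | t == x.1) e t *~ x.2)%R.
  rewrite /ev big_seq [RHS]big_seq; apply: eq_bigr => x xp.
  rewrite -big_filter filter_pred1_uniq ?undup_uniq ?big_seq1 //.
  by rewrite mem_undup map_f.
under eq_bigr => x _ do rewrite big_mkcond.
rewrite exchange_big big1 // => t _; rewrite -big_mkcond.
under eq_bigl => x do rewrite eq_sym.
by rewrite -(big_morph (fun c => e t *~ c)%R (mulrzDr _) (mulr0z _)) -/(coef p t) p0 mulr0z.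
Qed.

Lemma coef_neq0 p t : coef p t != 0%R -> exists2 x, x \in p & x.1 = t.
Proof.
move=> H; have /hasP[x xp /eqP xt] : has (fun x => x.1 == t) p; last by exists x.
apply: contraR H => /hasPn H; rewrite /coef big_seq_cond big1 // => x /andP[/H].
by move/negPf->.
Qed.

Lemma coef_push m p t : homogeneous (count id m) p -> size t.1 = count id m ->
  coef (push m p) (push_mon m t) = coef p t.
Proof.
move=> /allP hp st; rewrite /coef big_map big_seq_cond [RHS]big_seq_cond.
apply: eq_bigl => x; case xp: (x \in p) => //=.
have /andP[/eqP sx _] := hp _ xp.
apply/eqP/eqP => [|->//]; rewrite /push_mon => -[/ins_inj E j].
by rewrite [LHS]surjective_pairing [RHS]surjective_pairing j E.
Qed.

(** * Groebner bases for families of relations stable under insertion *)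

Section Noetherianity.
Variable K : nat -> combination -> Prop.
Hypothesis K_homogeneous : forall n p, K n p -> homogeneous n p.
Hypothesis K_cat : forall n p q, K n p -> K n q -> K n (p ++ q).
Hypothesis K_opp : forall n p, K n p -> K n (opp p).
Hypothesis K_push : forall m p, K (count id m) p -> K (size m) (push m p).

(** The leading coefficient is a positive natural number, so that it can join the monomial in
    Dickson's lemma; negative ones are treated through [opp]. *)
Definition leading n p (t : monomial) (c : nat) :=
  [/\ K n p, coef p t = c, 0 < c & forall t', rank t < rank t' -> coef p t' = 0%R].

(** Insertion is injective and monotone on monomials of the right length, so the leading term
    neither cancels nor is overtaken. *)
Lemma leading_push m p t c : leading (count id m) p t c ->
  leading (size m) (push m p) (push_mon m t) c.
Proof.
move=> [Kp pt c0 lt]; have hp := K_homogeneous Kp.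
have st x : x \in p -> size x.1.1 = count id m.
  by move=> /(allP hp)/andP[/eqP].
have [|x xp xt] := @coef_neq0 p t; first by rewrite pt; lia.
split=> //; first exact: K_push; first by rewrite coef_push // -xt st.
move=> t' tt'; have [//|/coef_neq0[_ /mapP[y yp ->] /= yt]] := eqVneq (coef (push m p) t') 0%R.
move: tt'; rewrite -yt coef_push ?st // => tt'; apply: lt.
rewrite ltnNge; apply/negP => le; move: tt'; rewrite ltnNge rank_push ?st //.
by rewrite -xt st.
Qed.

(** Dickson's lemma is applied to the pairs of leading monomial and leading coefficient; a
    dominating pair belongs to a short relation [q], and the embedding tells how to push it. *)
Lemma leading_terms_finitely_generated : exists N, forall n p t c,
  leading n p t c -> exists m q c',
    [/\ size m = n, count id m <= N, K (count id m) q,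
        leading n (push m q) t c' & c' <= c].
Proof.
pose L (x : monomial * nat) := exists n p, leading n p x.1 x.2.
have Lsize n p t c : leading n p t c -> size t.1 = n /\ count id t.1 <= B.
  case=> Kp pt c0 _; have [|x xp xt] := @coef_neq0 p t; first by rewrite pt; lia.
  by have /andP[/eqP] := allP (K_homogeneous Kp) _ xp; rewrite -xt.
have [x [n [p /Lsize[]]]//|N NP] := @monomials_finitely_dominated B R L.
exists N => n p t c H.
have [|[t' c'] /= [[n' [q ld]] s' [m cm em] ej cc]] := NP (t, c).
  by exists n, p.
have [sn _] := Lsize _ _ _ _ H; have [sn' _] := Lsize _ _ _ _ ld.
have sm : size m = n by rewrite -sn em size_ins.
have cn' : n' = count id m by rewrite cm /= sn'.
move: ld; rewrite cn' /= => ld; have [Kq _ _ _] := ld.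
exists m, q, c'; split=> //; first by rewrite cm.
have -> : t = push_mon m t' by rewrite [t]surjective_pairing em -ej.
by rewrite -sm; apply: leading_push.
Qed.

(* Leading coefficients are compared by size rather than by divisibility, as in
   Euclid's algorithm: each reduction decreases the positive leading coefficient,
   so that well-foundedness only needs Dickson's lemma, on monomials times nat. *)
Theorem relations_bounded_degree : exists N,
  forall n (V : zmodType) (e : monomial -> V),
  (forall m q, size m = n -> count id m <= N -> K (count id m) q ->
     ev e (push m q) = 0%R) ->
  forall p, K n p -> ev e p = 0%R.
Proof.
have [N NP] := leading_terms_finitely_generated.
exists N => n V e e0.
(* Outer induction on a strict bound [r] for the ranks occurring with nonzero coefficient. *)
suff H r p : K n p -> (forall t, r <= rank t -> coef p t = 0%R) -> ev e p = 0%R.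
  move=> p Kp; apply: (H (\max_(x <- p) rank x.1).+1) => // t tr.
  apply/eqP; apply: contraT => /coef_neq0[x xp xt].
  have := @leq_bigmax_seq _ p xpredT (fun x => rank x.1) x xp isT.
  by rewrite xt leqNgt tr.
elim: r p => [|r IH] p Kp pr; first by apply: ev_coef0 => t; apply: pr.
have [/asboolP[t [tr tp]]|/asboolPn no] :=
  boolP `[< exists t, rank t = r /\ coef p t <> 0%R >]; last first.
  apply: IH => // t; rewrite leq_eqVlt => /orP[/eqP tr|/pr//].
  by apply: contrapT => tp; apply: no; exists t.
(* Passing to the opposite if necessary, the coefficient of [t] is a natural number [c], on which
   the inner induction runs. *)
suff Hc c q : K n q -> (forall t, r < rank t -> coef q t = 0%R) ->
    coef q t = c%:Z%R -> ev e q = 0%R.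
  have [|] := boolP (0 <= coef p t)%R => pt; first by apply: (Hc `|coef p t|%N) => //; lia.
  apply: oppr_inj; rewrite -ev_opp oppr0; apply: (Hc `|coef p t|%N).
  - exact: K_opp.
  - by move=> t' /pr tt'; rewrite coef_opp tt' oppr0.
  - by rewrite coef_opp; lia.
have st : size t.1 = n.
  have [|x xp <-] := @coef_neq0 p t; first exact/eqP.
  by have /andP[/eqP] := allP (K_homogeneous Kp) _ xp.
elim/ltn_ind: c q => -[|c] IHc q Kq qr qt.
  (* If [c] is zero, nothing of rank [r] is left, because [t] is the only monomial of its length and
     rank. *)
  apply: IH => // t'; rewrite leq_eqVlt => /orP[/eqP tr'|/qr//].
  apply/eqP; apply: contraT => t'0; have [x xq xt] := coef_neq0 t'0.
  have /andP[/eqP sx _] := allP (K_homogeneous Kq) _ xq.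
  by rewrite -(@rank_inj t t') ?qt ?tr ?st -?xt ?sx // xt in t'0.
have [m [q' [c' [sm cN Kq' [Kpq pt c0 lt] cc]]]] : exists m q' c', [/\ size m = n,
    count id m <= N, K (count id m) q', leading n (push m q') t c' & c' <= c.+1].
  by apply: (NP n q); split=> // t'; rewrite tr; apply: qr.
(* Subtracting a push of value zero lowers the coefficient of [t] by the positive number [c']. *)
have <- : ev e (q ++ opp (push m q')) = ev e q.
  by rewrite ev_cat ev_opp e0 // oppr0 addr0.
apply: (IHc (c.+1 - c')); first by lia.
- by apply: K_cat => //; apply: K_opp.
- by move=> t' tt'; rewrite coef_cat coef_opp qr // lt ?tr // subr0.
- by rewrite coef_cat coef_opp qt pt; lia.
Qed.

End Noetherianity.
End Relations.

(** * Groups *)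

Section GroupTheory.
Variable A : group.
Implicit Types (x y z g h : A).

Lemma gmulVr x : gmul x (ginv x) = gone.
Proof.
rewrite -[LHS]gmul1 -{1}(gmulV (ginv x)) -gmulA [gmul (ginv x) _]gmulA.
by rewrite gmulV gmul1 gmulV.
Qed.

Lemma gmulr1 x : gmul x gone = x.
Proof. by rewrite -(gmulV x) gmulA gmulVr gmul1. Qed.

Lemma gmulK x y : gmul (gmul x y) (ginv y) = x.
Proof. by rewrite -gmulA gmulVr gmulr1. Qed.

Lemma gmulVK x y : gmul (gmul x (ginv y)) y = x.
Proof. by rewrite -gmulA gmulV gmulr1. Qed.

Lemma ginv_eq x y : gmul x y = gone -> ginv x = y.
Proof. by move=> E; rewrite -[LHS]gmulr1 -E gmulA gmulV gmul1. Qed.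

Lemma ginvK x : ginv (ginv x) = x.
Proof. exact/ginv_eq/gmulV. Qed.

Lemma ginv1 : ginv gone = gone :> A.
Proof. exact/ginv_eq/gmul1. Qed.

Lemma ginvM x y : ginv (gmul x y) = gmul (ginv y) (ginv x).
Proof. by apply: ginv_eq; rewrite gmulA gmulK gmulVr. Qed.

(* Rewriting with this set reduces group words to a left-associated free normal form. *)
Definition gnorm :=
  (ginvM, ginvK, ginv1, gmulA, gmulV, gmulVr, gmul1, gmulr1, gmulK, gmulVK).

Lemma gconjM x y g : gconj (gmul x y) g = gmul (gconj x g) (gconj y g).
Proof. by rewrite /gconj !gnorm. Qed.

Lemma gconjV x g : gconj (ginv x) g = ginv (gconj x g).
Proof. by rewrite /gconj !gnorm. Qed.

Lemma gconj1 g : gconj gone g = gone :> A.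
Proof. by rewrite /gconj !gnorm. Qed.

Lemma gconjx1 x : gconj x gone = x.
Proof. by rewrite /gconj !gnorm. Qed.

Lemma gconjJ x g h : gconj (gconj x g) h = gconj x (gmul g h).
Proof. by rewrite /gconj !gnorm. Qed.

Lemma gen_subgroup (S : A -> Prop) : is_subgroup (gen S).
Proof.
split; [exact: gen_one | exact: gen_mul | exact: gen_inv].
Qed.

Lemma gen_min (S H : A -> Prop) : is_subgroup H ->
  (forall x, S x -> H x) -> forall x, gen S x -> H x.
Proof.
by move=> [H1 HM HV] SH x; elim=> {x} *; [apply: SH|apply: H1|apply: HM|apply: HV].
Qed.

Lemma gen_normal (S : A -> Prop) : (forall x g, S x -> S (gconj x g)) ->
  is_normal_subgroup (gen S).
Proof.
move=> SJ; split=> [|x g]; first exact: gen_subgroup.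
elim=> {x} [x Sx||x y _ IHx _ IHy|x _ IHx].
- exact/gen_base/SJ.
- by rewrite gconj1; apply: gen_one.
- by rewrite gconjM; apply: gen_mul.
- by rewrite gconjV; apply: gen_inv.
Qed.

Definition conjugate x y := exists g, y = gconj x g.

Lemma conjugate_sym x y : conjugate x y -> conjugate y x.
Proof. by case=> g ->; exists (ginv g); rewrite gconjJ gmulVr gconjx1. Qed.

Lemma conjugate_trans x y z : conjugate x y -> conjugate y z -> conjugate x z.
Proof. by move=> [g ->] [h ->]; exists (gmul g h); rewrite gconjJ. Qed.

(** * Congruence modulo a normal subgroup *)

Section Congruence.
Variable D : A -> Prop.
Hypothesis nD : is_normal_subgroup D.

Definition congruent x y := D (gmul (ginv x) y).

Lemma congruent_refl x : congruent x x.
Proof. by rewrite /congruent gmulV; case: nD => -[]. Qed.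

Lemma congruent_sym x y : congruent x y -> congruent y x.
Proof. by rewrite /congruent; case: nD => -[_ _ DV] _ /DV; rewrite !gnorm. Qed.

Lemma congruent_trans x y z : congruent x y -> congruent y z -> congruent x z.
Proof.
rewrite /congruent; case: nD => -[_ DM _] _ xy yz.
by have := DM _ _ xy yz; rewrite !gnorm.
Qed.

Lemma congruentM x x' y y' :
  congruent x y -> congruent x' y' -> congruent (gmul x x') (gmul y y').
Proof.
rewrite /congruent; case: nD => -[_ DM _] DJ /(DJ _ x') xy xy'.
by have := DM _ _ xy xy'; rewrite /gconj !gnorm.
Qed.

Lemma congruentV x y : congruent x y -> congruent (ginv x) (ginv y).
Proof.
rewrite /congruent; case: nD => -[_ _ DV] DJ /DV/(DJ _ (ginv x)).
by rewrite /gconj !gnorm.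
Qed.

Lemma congruent1 x : congruent gone x <-> D x.
Proof. by rewrite /congruent !gnorm. Qed.

Lemma congruent_comm x y : D (gcomm x y) <-> congruent (gmul y x) (gmul x y).
Proof. by rewrite /congruent /gcomm !gnorm. Qed.

(** This reduces commutation modulo [D] to generators. *)
Lemma commutant_subgroup (H : A -> Prop) :
  is_subgroup (fun x => forall y, H y -> D (gcomm x y)).
Proof.
split=> [y _|x x' cx cx' y Hy|x cx y Hy].
- by apply/congruent_comm; rewrite !gnorm; apply: congruent_refl.
- apply/congruent_comm; rewrite gmulA.
  apply: (@congruent_trans _ (gmul (gmul x y) x')).
    by apply: congruentM (congruent_refl _); apply/congruent_comm/cx.
  by rewrite -!gmulA; apply: congruentM (congruent_refl _) _; apply/congruent_comm/cx'.
- apply/congruent_comm/congruent_sym.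
  have /congruent_comm c := cx y Hy.
  have := congruentM (congruentM (congruent_refl (ginv x)) c) (congruent_refl (ginv x)).
  by rewrite !gnorm.
Qed.

Lemma gcomm_sym x y : D (gcomm x y) -> D (gcomm y x).
Proof. by move/congruent_comm/congruent_sym/congruent_comm. Qed.

End Congruence.

(** * Central quotients as abelian groups *)

Definition additive_on (H : A -> Prop) (V : zmodType) (f : A -> V) :=
  forall x y, H x -> H y -> f (gmul x y) = (f x + f y)%R.

(** The quotient of [H] by [D] is realized by cosets taken as predicates; [f] is total, but only its
    values on [H] matter. *)
Lemma central_quotient (H D : A -> Prop) :
  is_subgroup H -> is_normal_subgroup D -> (forall x, D x -> H x) ->
  (forall g x, H x -> D (gcomm g x)) ->
  exists (V : zmodType) (f : A -> V), [/\ additive_on H f,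
    forall x, H x -> f x = 0%R <-> D x & forall x g, H x -> f (gconj x g) = f x].
Proof.
move=> [H1 HM HV] nD DH cD.
pose T := {C : A -> Prop | exists2 x, H x & C = congruent D x}.
have T_inj (c d : T) : sval c = sval d -> c = d.
  by case: c d => [C c] [C' c'] /= E; apply: eq_exist.
(* Outside [H] the class is unconstrained, and the trivial coset serves as witness. *)
have cls_ex x : exists c : T, H x -> sval c = congruent D x.
  have [Hx|nHx] := pselect (H x).
    by exists (exist _ (congruent D x) (ex_intro2 _ _ x Hx erefl)).
  by exists (exist _ (congruent D gone) (ex_intro2 _ _ gone H1 erefl)).
have [cls clsE] := choice cls_ex.
have cls_eq x y : H x -> H y -> cls x = cls y <-> congruent D x y.
  move=> Hx Hy; split=> [E|xy].
    by have := congruent_refl nD y; rewrite -(clsE y Hy) -E clsE.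
  apply: T_inj; rewrite !clsE //; apply/funext => z; apply/propext; split.
    by apply: (congruent_trans nD); apply: congruent_sym.
  exact: congruent_trans.
have rep_ex (c : T) : exists x, H x /\ cls x = c.
  by case: c => C [x Hx CE]; exists x; split=> //; apply: T_inj; rewrite clsE.
have [rep repP] := choice rep_ex.
have Hrep c : H (rep c) by case: (repP c).
have repK c : cls (rep c) = c by case: (repP c).
have rep_cls x : H x -> congruent D (rep (cls x)) x.
  by move=> Hx; apply/cls_eq.
pose add c d := cls (gmul (rep c) (rep d)).
pose opp c := cls (ginv (rep c)).
have clsM x y : H x -> H y -> cls (gmul x y) = add (cls x) (cls y).
  move=> Hx Hy; apply/cls_eq; try exact: HM.
  by apply: congruentM => //; apply: congruent_sym => //; apply: rep_cls.
have clsV x : H x -> cls (ginv x) = opp (cls x).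
  move=> Hx; apply/cls_eq; try exact: HV.
  by apply: congruentV => //; apply: congruent_sym => //; apply: rep_cls.
have addA : associative add.
  by move=> a b c; rewrite -[a]repK -[b]repK -[c]repK -!clsM ?gmulA //; apply: HM.
have addC : commutative add.
  move=> a b; rewrite -[a]repK -[b]repK -!clsM //; apply/cls_eq; try exact: HM.
  by apply/congruent_comm/cD.
have add0 : left_id (cls gone) add by move=> a; rewrite -[a]repK -clsM ?gmul1.
have addN : left_inverse (cls gone) opp add.
  by move=> a; rewrite -[a]repK -clsV // -clsM ?gmulV //; apply: HV.
pose cT : choiceType := HB.pack T (@gen_eqMixin T) (@gen_choiceMixin T).
pose V : zmodType := HB.pack (Choice.sort cT) (GRing.isZmodule.Build cT addA addC add0 addN).
exists V, cls; split=> [x y Hx Hy|x Hx|x g Hx].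
- exact: clsM.
- split=> [E|Dx].
    by apply/congruent1/(cls_eq _ _ H1 Hx); rewrite E.
  by apply/(cls_eq _ _ Hx H1)/(congruent_sym nD)/congruent1.
- have Dc : D (gcomm x g) by apply: gcomm_sym => //; apply: cD.
  (* Conjugation changes [x] by a commutator, which lies in [D]. *)
  have E : gconj x g = gmul x (gcomm x g) by rewrite /gconj /gcomm !gnorm.
  have Hc := DH _ Dc; rewrite E; apply/cls_eq => //; first exact: HM.
  apply: congruent_sym => //; rewrite /congruent !gnorm.
  by case: nD => -[_ _ DV] _; have := DV _ Dc; rewrite !gnorm.
Qed.

(** * Integral powers and ordered products *)

Definition gexpz x (c : int) : A :=
  match c with
  | Posz n => iter n (gmul x) gone
  | Negz n => ginv (iter n.+1 (gmul x) gone)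
  end.

Lemma gexpz_in (H : A -> Prop) x c : is_subgroup H -> H x -> H (gexpz x c).
Proof.
move=> [H1 HM HV] Hx.
have Hn n : H (iter n (gmul x) gone) by elim: n => //= n IH; apply: HM.
by case: c => n; [apply: Hn | apply/HV/Hn].
Qed.

Section AdditiveOn.
Variables (H : A -> Prop) (V : zmodType) (f : A -> V).
Hypotheses (sH : is_subgroup H) (fD : additive_on H f).

Lemma additive_on1 : f gone = 0%R.
Proof.
case: sH => H1 _ _; apply: (addrI (f gone)).
by rewrite -fD // gmul1 addr0.
Qed.

Lemma additive_onV x : H x -> f (ginv x) = (- f x)%R.
Proof.
case: sH => H1 _ HV Hx; apply: (addIr (f x)); rewrite -fD //; last exact: HV.
by rewrite gmulV additive_on1 addNr.
Qed.

Lemma additive_onX x c : H x -> f (gexpz x c) = (f x *~ c)%R.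
Proof.
move=> Hx; have fn n : f (iter n (gmul x) gone) = (f x *+ n)%R.
  elim: n => [|n IH]; first exact: additive_on1.
  by rewrite iterS fD ?IH ?mulrS //; apply: (@gexpz_in H x n).
case: c => n; first exact: fn.
by rewrite /= -[gmul x _]/(iter n.+1 _ _) additive_onV ?fn //; apply: (@gexpz_in H x n.+1).
Qed.

End AdditiveOn.

Section EvalProduct.
Variables (M : Type).
Implicit Types (e : M -> A) (p : seq (M * int)).

(** A lift of an integral combination to a nonabelian group, with the factors in list order; in an
    abelian quotient it becomes [ev]. *)
Definition evprod e p : A :=
  foldr (fun t z => gmul (gexpz (e t.1) t.2) z) gone p.

Lemma evprod_in (H : A -> Prop) e p :
  is_subgroup H -> (forall t, H (e t)) -> H (evprod e p).
Proof.
move=> sH He; elim: p => [|x p IH] /=; first by case: sH.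
by have [_ HM _] := sH; apply: HM => //; apply: gexpz_in.
Qed.

End EvalProduct.
End GroupTheory.

Lemma evprod_additive (A : group) (R : nat) (H : A -> Prop) (V : zmodType)
    (f : A -> V) (e : bitseq * 'I_R -> A) p :
  is_subgroup H -> additive_on H f -> (forall t, H (e t)) ->
  f (evprod e p) = ev (f \o e) p.
Proof.
move=> sH fD He; elim: p => [|x p IH].
  by rewrite /ev big_nil (additive_on1 sH fD).
rewrite /ev big_cons /= fD; first by rewrite (additive_onX sH fD) // IH.
  exact: gexpz_in.
exact: evprod_in.
Qed.

(** * Homomorphisms of groups *)

Section Homomorphisms.
Variables (A A' : group) (f : A -> A').
Hypothesis fM : is_hom f.

Lemma hom1 : f gone = gone.
Proof. by rewrite -[LHS](gmulK _ (f gone)) -fM gmul1 gmulVr. Qed.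

Lemma homV x : f (ginv x) = ginv (f x).
Proof. by apply/esym/ginv_eq; rewrite -fM gmulVr hom1. Qed.

Lemma hom_conj x g : f (gconj x g) = gconj (f x) (f g).
Proof. by rewrite /gconj !fM homV. Qed.

Lemma hom_comm x y : f (gcomm x y) = gcomm (f x) (f y).
Proof. by rewrite /gcomm !fM !homV. Qed.

Lemma hom_conjugate x y : conjugate x y -> conjugate (f x) (f y).
Proof. by case=> g ->; exists (f g); rewrite hom_conj. Qed.

Lemma hom_evprod M (e : M -> A) p : f (evprod e p) = evprod (f \o e) p.
Proof.
elim: p => [|x p IH] /=; first exact: hom1.
rewrite fM IH; congr gmul.
have fn n : f (iter n (gmul (e x.1)) gone) = iter n (gmul (f (e x.1))) gone.
  by elim: n => [|n IHn]; [exact: hom1 | rewrite !iterS fM IHn].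
by case: x.2 => n; [exact: fn | rewrite /gexpz homV fn].
Qed.

End Homomorphisms.

(** * Weak FI-groups *)

Local Open Scope fset_scope.
Local Notation elts J := (sort leq (enum_fset J)).

(** * Finite subsets encoded by words, and injections between them *)

Definition sub (J : {fset nat}) (w : bitseq) : {fset nat} :=
  [fset x in mask w (elts J)].
Definition initial (n : nat) : {fset nat} := [fset x in iota 0 n].
Definition nth_elt (J : {fset nat}) (i : nat) : nat := nth 0 (elts J) i.
Definition elt_index (J : {fset nat}) (x : nat) : nat := index x (elts J).

Lemma elts_uniq J : uniq (elts J).
Proof. by rewrite sort_uniq fset_uniq. Qed.

Lemma mem_elts J : elts J =i J.
Proof. by move=> x; rewrite mem_sort. Qed.

Lemma size_elts J : size (elts J) = #|` J|.
Proof. by rewrite size_sort cardfE. Qed.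

Lemma elts_sorted J : sorted leq (elts J).
Proof. exact/sort_sorted/leq_total. Qed.

Lemma elts_sub J w : elts (sub J w) = mask w (elts J).
Proof.
apply: (sorted_eq leq_trans anti_leq); first exact: elts_sorted.
  exact: (subseq_sorted leq_trans (mask_subseq _ _) (elts_sorted J)).
apply: uniq_perm; first exact: elts_uniq.
  by rewrite mask_uniq ?elts_uniq.
by move=> x; rewrite mem_elts inE.
Qed.

Lemma sub_fsub J w : sub J w `<=` J.
Proof. by apply/fsubsetP => x; rewrite inE => /mem_mask; rewrite mem_elts. Qed.

Lemma card_sub J w : size w = #|` J| -> #|` sub J w| = count id w.
Proof. by move=> sw; rewrite -size_elts elts_sub size_mask // size_elts. Qed.

(** Composition of increasing injections, seen on subsets of subsets. *)
Lemma sub_ins J m w : count id m = size w -> sub (sub J m) w = sub J (ins m w).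
Proof. by move=> cm; rewrite /sub elts_sub mask_ins. Qed.

Lemma sub_word (I J : {fset nat}) : I `<=` J ->
  sub J [seq x \in I | x <- elts J] = I.
Proof.
move=> /fsubsetP IJ; apply/fsetP => x; rewrite inE -filter_mask mem_filter mem_elts.
by apply: andb_idr; apply: IJ.
Qed.

Lemma nth_elt_FI_map J n : n = #|` J| -> FI_map (initial n) J (nth_elt J).
Proof.
move=> ->; split=> [i j|i]; rewrite !inE !mem_iota /= add0n -size_elts => iJ.
  by move=> jJ /eqP; rewrite nth_uniq ?elts_uniq // => /eqP.
by rewrite -mem_elts mem_nth.
Qed.

Lemma elt_index_FI_map J : FI_map J (initial #|` J|) (elt_index J).
Proof.
split=> [x y|x]; rewrite -mem_elts => xJ.
  by rewrite -mem_elts => yJ /(congr1 (nth 0 (elts J))); rewrite !nth_index.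
by rewrite inE mem_iota /= add0n -size_elts index_mem.
Qed.

Lemma id_FI_map (I J : {fset nat}) : I `<=` J -> FI_map I J id.
Proof. by move=> /fsubsetP IJ; split. Qed.

Lemma comp_FI_map (I J L : {fset nat}) f g :
  FI_map I J f -> FI_map J L g -> FI_map I L (g \o f).
Proof.
move=> [fi fm] [gi gm]; split=> [x y xI yI|x xI]; last exact/gm/fm.
by move=> /gi/fi; apply=> //; apply: fm.
Qed.

(** * Functoriality up to conjugacy *)

Section WeakFIgroups.
Variable G : weakFIgroup.

Lemma Ginc_conjugate (I J : {fset nat}) (x : G I) : I `<=` J ->
  conjugate (Ginc G I J x) (Gmap G I J id x).
Proof.
move=> /(Ginc_rep G)[g H]; apply: conjugate_sym; exists g; exact: H.
Qed.

Lemma Gmap_comp_conjugate (I J L : {fset nat}) f g (x : G I) :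
  FI_map I J f -> FI_map J L g ->
  conjugate (Gmap G J L g (Gmap G I J f x)) (Gmap G I L (g \o f) x).
Proof.
move=> Hf Hg; have [h H] := Gmap_comp G _ _ _ _ _ Hf Hg.
by apply: conjugate_sym; exists h; apply: H.
Qed.

Lemma Gmap_ext_conjugate (I J : {fset nat}) f g (x : G I) :
  FI_map I J f -> {in I, f =1 g} -> conjugate (Gmap G I J f x) (Gmap G I J g x).
Proof.
by move=> Hf fg; have [h H] := Gmap_ext G _ _ _ _ Hf fg; exists h; apply: H.
Qed.

Lemma Ginc_Gmap_conjugate (L S J J' : {fset nat}) f h (x : G L) :
  FI_map L S h -> S `<=` J -> FI_map J J' f ->
  conjugate (Gmap G J J' f (Ginc G S J (Gmap G L S h x))) (Gmap G L J' (f \o h) x).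
Proof.
move=> Hh SJ Hf; have Hid := id_FI_map SJ.
apply: (@conjugate_trans _ _ (Gmap G J J' f (Gmap G L J (id \o h) x))).
  apply: hom_conjugate; first exact: Gmap_hom.
  exact: conjugate_trans (Ginc_conjugate _ SJ) (Gmap_comp_conjugate _ Hh Hid).
exact: Gmap_comp_conjugate (comp_FI_map Hh Hid) Hf.
Qed.

(** * Monomials in a weak FI-group *)

Section Monomials.
Variables (R : nat) (v : forall b : nat, 'I_R -> G (initial b)).

(** The increasing injection is factored through [S], with the strict inclusion last, so that
    inclusions carry monomials to monomials exactly and not just up to conjugacy. *)
Definition monomial_at (J S : {fset nat}) (j : 'I_R) : G J :=
  Ginc G S J (Gmap G (initial #|` S|) S (nth_elt S) (v #|` S| j)).
Definition monomial_value (J : {fset nat}) (t : bitseq * 'I_R) : G J :=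
  monomial_at J (sub J t.1) t.2.

Lemma Ginc_monomial (J : {fset nat}) m t : count id m = size t.1 ->
  Ginc G (sub J m) J (monomial_value (sub J m) t) = monomial_value J (push_mon m t).
Proof.
move=> cm; rewrite /monomial_value /= -sub_ins // /monomial_at.
rewrite -[LHS]/((Ginc G _ J \o Ginc G _ (sub J m)) _) Ginc_trans //; exact: sub_fsub.
Qed.

(** The increasing bijection [f] matches the enumerations of corresponding subsets, so both sides
    are images of one generator under the same injection. *)
Lemma Gmap_monomial (J J' : {fset nat}) t : #|` J| = #|` J'| ->
  let f := nth_elt J' \o elt_index J in
  conjugate (Gmap G J J' f (monomial_value J t)) (monomial_value J' t).
Proof.
move=> JJ' f.
have Hf : FI_map J J' f.
  by apply: comp_FI_map (elt_index_FI_map J) _; apply: nth_elt_FI_map.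
have fJ : map f (elts J) = elts J'.
  apply: (@eq_from_nth _ 0); rewrite size_map !size_elts // => i iJ.
  rewrite (nth_map 0) ?size_elts // /f /= /elt_index index_uniq ?size_elts ?elts_uniq //.
have fS : map f (elts (sub J t.1)) = elts (sub J' t.1) by rewrite !elts_sub map_mask fJ.
have cS : #|` sub J t.1| = #|` sub J' t.1| by rewrite -!size_elts -fS size_map.
rewrite /monomial_value /monomial_at cS.
have HS : FI_map (initial #|` sub J' t.1|) (sub J t.1) (nth_elt (sub J t.1)).
  exact: nth_elt_FI_map.
have HS' : FI_map (initial #|` sub J' t.1|) (sub J' t.1) (nth_elt (sub J' t.1)).
  exact: nth_elt_FI_map.
apply: conjugate_trans (Ginc_Gmap_conjugate _ HS (sub_fsub _ _) Hf) _.
apply: (@conjugate_trans _ _ (Gmap G _ J' (id \o nth_elt (sub J' t.1)) (v _ t.2))).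
  apply: Gmap_ext_conjugate => [|i].
    exact: comp_FI_map (comp_FI_map HS (id_FI_map (sub_fsub _ _))) Hf.
  rewrite inE mem_iota /= add0n -cS -size_elts => iS.
  by rewrite /nth_elt -fS (nth_map 0).
apply: conjugate_sym; apply: conjugate_trans (Ginc_conjugate _ (sub_fsub _ _)) _.
exact: Gmap_comp_conjugate HS' (id_FI_map (sub_fsub _ _)).
Qed.

Lemma Ginc_evprod B (J : {fset nat}) m p : homogeneous B (count id m) p ->
  Ginc G (sub J m) J (evprod (monomial_value (sub J m)) p) =
  evprod (monomial_value J) (push m p).
Proof.
move=> hp; rewrite (hom_evprod (Ginc_hom G _ _ (sub_fsub J m))).
elim: p hp => //= x p IH /andP[/andP[/eqP sx _] /IH ->].
by rewrite Ginc_monomial.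
Qed.

End Monomials.

(** * Graded pieces of a central filtration *)

Section Graded.
Variable Gf : nat -> FIsubset G.
Arguments Gf : clear implicits.
Hypotheses (filtG : central_filtration Gf) (frG : finite_rank Gf).
Variables (k : nat) (k1 : 1 <= k).

Lemma Gf_normal i I : 1 <= i -> is_normal_subgroup (Gf i I).
Proof. by case: filtG => H _ _ _ /H[]. Qed.

Lemma Gf_subgroup i I : 1 <= i -> is_subgroup (Gf i I).
Proof. by move=> /(Gf_normal I)[]. Qed.

Lemma Gf_map i I J f x : 1 <= i -> FI_map I J f -> Gf i I x -> Gf i J (Gmap G I J f x).
Proof. by case: filtG => H _ _ _ /H[_ mapH] /mapH; apply. Qed.

Lemma Gf_conjugate i I x y : 1 <= i -> conjugate x y -> Gf i I x -> Gf i I y.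
Proof. by move=> /(Gf_normal I)[_ H] [g ->] /H. Qed.

Lemma Gf_inc i (I J : {fset nat}) x : 1 <= i -> I `<=` J ->
  Gf i I x -> Gf i J (Ginc G I J x).
Proof.
move=> i1 IJ xI; apply: (Gf_conjugate i1 (conjugate_sym (Ginc_conjugate x IJ))).
exact: Gf_map (id_FI_map IJ) xI.
Qed.

Lemma Gf_comm I (g x : G I) : Gf k I x -> Gf k.+1 I (gcomm g x).
Proof.
by case: filtG => _ _ _ H xk; apply: H => //; apply: gen_base; exists g, x.
Qed.

Lemma Gf_succ I (x : G I) : Gf k.+1 I x -> Gf k I x.
Proof. by case: filtG => _ _ H _; apply: H. Qed.

Lemma graded_piece I : exists (V : zmodType) (f : G I -> V),
  [/\ additive_on (Gf k I) f, forall x, Gf k I x -> f x = 0%R <-> Gf k.+1 I x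
    & forall x g, Gf k I x -> f (gconj x g) = f x].
Proof.
apply: central_quotient; first exact: Gf_subgroup.
- exact: Gf_normal.
- exact: Gf_succ.
- by move=> g x; apply: Gf_comm.
Qed.

(** * Generators of the graded pieces and their relations *)

Section WithGenerators.
Variables (R : nat) (v : forall b : nat, 'I_R -> G (initial b)).
Hypothesis v_in : forall b j, Gf k (initial b) (v b j).
Local Notation value := (monomial_value v).

Lemma value_in J t : Gf k J (value J t).
Proof.
apply: Gf_inc => //; first exact: sub_fsub.
by apply: Gf_map => //; apply: nth_elt_FI_map.
Qed.

Lemma evprod_value_in J p : Gf k J (evprod (value J) p).
Proof. by apply: evprod_in; [exact: Gf_subgroup | exact: value_in]. Qed.

(** The increasing bijection moves monomials to conjugates, and conjugation is invisible in the
    graded piece; hence relations depend only on the size of [J]. *)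
Lemma evprod_transfer (J J' : {fset nat}) p : #|` J| = #|` J'| ->
  Gf k.+1 J (evprod (value J) p) -> Gf k.+1 J' (evprod (value J') p).
Proof.
move=> JJ' pJ; have [V [f [fD f0 fJ]]] := graded_piece J'.
pose h := nth_elt J' \o elt_index J.
have Hh : FI_map J J' h.
  by apply: comp_FI_map (elt_index_FI_map J) _; apply: nth_elt_FI_map.
have Hhom : is_hom (Gmap G J J' h) by apply: Gmap_hom.
apply/f0; first exact: evprod_value_in.
have <- : f (Gmap G J J' h (evprod (value J) p)) = f (evprod (value J') p).
  rewrite (hom_evprod Hhom) !(evprod_additive _ (Gf_subgroup J' k1) fD); last first.
  - by move=> t; apply: Gf_map => //; apply: value_in.
  - exact: value_in.
  apply: eq_bigr => x _; congr (_ *~ _)%R => /=.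
  have [g ->] := Gmap_monomial v x.1 JJ'.
  by rewrite fJ //; apply: Gf_map => //; apply: value_in.
by apply/f0; [apply: Gf_map => //; apply: evprod_value_in | apply: Gf_map].
Qed.

(** Quantifying over all [J] of size [n] makes this a family indexed by degree alone, as the
    Groebner argument requires. *)
Definition relation B n p := homogeneous B n p /\
  forall J : {fset nat}, #|` J| = n -> Gf k.+1 J (evprod (value J) p).

Lemma graded_evprod J (V : zmodType) (f : G J -> V) p :
  additive_on (Gf k J) f -> f (evprod (value J) p) = ev (f \o value J) p.
Proof.
by move=> fD; apply: (evprod_additive _ (Gf_subgroup J k1) fD); apply: value_in.
Qed.

Lemma relation_cat B n p q : relation B n p -> relation B n q -> relation B n (p ++ q).
Proof.
move=> [hp pK] [hq qK]; split=> [|J cJ]; first by rewrite /homogeneous all_cat; apply/andP.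
have [V [f [fD f0 _]]] := graded_piece J.
apply/f0; first exact: evprod_value_in.
rewrite graded_evprod // ev_cat -!graded_evprod //.
by rewrite !(proj2 (f0 _ (evprod_value_in _ _))) ?addr0 //; [apply: qK | apply: pK].
Qed.

Lemma relation_opp B n p : relation B n p -> relation B n (opp p).
Proof.
move=> [hp pK]; split=> [|J cJ]; first by rewrite /homogeneous all_map.
have [V [f [fD f0 _]]] := graded_piece J.
apply/f0; first exact: evprod_value_in.
rewrite graded_evprod // ev_opp -graded_evprod //.
by rewrite (proj2 (f0 _ (evprod_value_in _ _))) ?oppr0 //; apply: pK.
Qed.

Lemma relation_push B m p : relation B (count id m) p -> relation B (size m) (push m p).
Proof.
move=> [hp pK]; split=> [|J cJ].
  rewrite /homogeneous all_map; apply: sub_all hp => x /= /andP[/eqP sx cx].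
  by rewrite size_ins count_ins // eqxx.
rewrite -(Ginc_evprod v J hp); apply: Gf_inc => //; first exact: sub_fsub.
by apply: pK; rewrite card_sub.
Qed.

Lemma combination_of_gen (A : group) B n (H S : A -> Prop) (V : zmodType)
    (f : A -> V) (e : bitseq * 'I_R -> V) :
  is_subgroup H -> additive_on H f -> (forall x, S x -> H x) ->
  (forall x, S x -> exists2 p, homogeneous B n p & f x = ev e p) ->
  forall x, gen S x -> exists2 p, homogeneous B n p & f x = ev e p.
Proof.
move=> sH fD SH Sp x gx; have Hgen y := @gen_min A S H sH SH y.
elim: gx => {x} [x /Sp//||x y gx [p hp fp] gy [q hq fq]|x gx [p hp fp]].
- by exists [::]; rewrite // /ev big_nil (additive_on1 sH fD).
- exists (p ++ q); first by rewrite /homogeneous all_cat; apply/andP.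
  by rewrite ev_cat -fp -fq fD //; apply: Hgen.
- exists (opp p); first by rewrite /homogeneous all_map.
  by rewrite ev_opp -fp (additive_onV sH fD) //; apply: Hgen.
Qed.

(** Stated for any [f] killing the degree [k.+1] part that comes from small subsets, so that it
    applies to quotients possibly larger than the graded piece. *)
Lemma monomials_generate B J (V : zmodType) (f : G J -> V) :
  (forall b x, b <= B -> Gf k (initial b) x -> exists2 y,
     gen (fun a => exists j, a = v b j) y & Gf k.+1 (initial b) (gmul (ginv y) x)) ->
  boundedly_normally_generated_in (Gf k) B ->
  additive_on (Gf k J) f ->
  (forall x g, Gf k J x -> f (gconj x g) = f x) ->
  (forall I z, I `<=` J -> #|` I| <= B -> Gf k.+1 I z -> f (Ginc G I J z) = 0%R) ->
  forall x, Gf k J x -> exists2 p, homogeneous B #|` J| p & f x = ev (f \o value J) p.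
Proof.
move=> v_gen bng fD fJ f0 x /bng gx; have sH := Gf_subgroup J k1.
apply: (combination_of_gen sH fD) gx => {x} [x Sx|_ [I [IJ cI] [_ [x xI ->] [g ->]]]].
  exact/bng/gen_base.
have xH : Gf k J (Ginc G I J x) by apply: Gf_inc.
have kmap h z : FI_map (initial #|` I|) I h -> Gf k (initial #|` I|) z ->
    Gf k I (Gmap G (initial #|` I|) I h z) by apply: Gf_map.
have incD y z : Gf k I y -> Gf k I z ->
    f (Ginc G I J (gmul y z)) = (f (Ginc G I J y) + f (Ginc G I J z))%R.
  by move=> yI zI; rewrite (Ginc_hom G) // fD //; apply: Gf_inc.
(* The generators [v] live over initial segments, so [x] is moved there, approximated by [y] and
   moved back. *)
pose z := Gmap G I (initial #|` I|) (elt_index I) x.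
have zk : Gf k (initial #|` I|) z by apply: Gf_map => //; apply: elt_index_FI_map.
have Hn : FI_map (initial #|` I|) I (nth_elt I) by apply: nth_elt_FI_map.
have Hhom := Gmap_hom G _ _ _ Hn.
have [y gy yz] := v_gen _ _ cI zk.
have vk : forall a, (exists j, a = v #|` I| j) -> Gf k (initial #|` I|) a.
  by move=> _ [j ->]; apply: v_in.
have yk : Gf k (initial #|` I|) y by apply: gen_min gy => //; apply: Gf_subgroup.
have -> : f (gconj (Ginc G I J x) g) = f (Ginc G I J (Gmap G _ I (nth_elt I) y)).
  rewrite fJ //.
  have [h xh] : conjugate (Gmap G _ I (nth_elt I) z) x.
    apply: conjugate_trans (Gmap_comp_conjugate x (elt_index_FI_map I) Hn) _.
    apply: (@conjugate_trans _ _ (Gmap G I I id x)).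
      apply: Gmap_ext_conjugate => [|i iI].
        exact: comp_FI_map (elt_index_FI_map I) Hn.
      by rewrite /= /nth_elt /elt_index nth_index // mem_elts.
    by have [h H] := Gmap_id G I; exists h; apply: H.
  rewrite xh (hom_conj (Ginc_hom G _ _ IJ)) fJ; last first.
    by apply: Gf_inc => //; apply: kmap.
  (* The error of the approximation lies in [Gf k.+1] over a set of size at most [B], where [f]
     vanishes. *)
  have -> : z = gmul y (gmul (ginv y) z) by rewrite !gnorm.
  rewrite Hhom incD; [|exact: kmap|by apply: kmap => //; apply: Gf_succ].
  by rewrite [X in (_ + X)%R]f0 ?addr0 //; apply: Gf_map.
apply: (@combination_of_gen _ B #|` J| (Gf k (initial #|` I|))
  (fun a => exists j, a = v #|` I| j) _
  (fun a => f (Ginc G I J (Gmap G _ I (nth_elt I) a)))) gy => //.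
- exact: Gf_subgroup.
- by move=> a b ak bk; rewrite Hhom incD //; apply: kmap.
(* A single monomial, given by the characteristic word of [I] in [J]. *)
move=> _ [j ->]; exists [:: ((([seq x \in I | x <- elts J], j) : bitseq * 'I_R), 1%R : int)].
  rewrite /homogeneous /= size_map size_elts eqxx andbT /=.
  by rewrite -(@card_sub J) ?size_map ?size_elts ?sub_word.
by rewrite /ev big_seq1 mulr1z /= /monomial_value /= sub_word.
Qed.

End WithGenerators.

(** * Finite generating families in bounded degree *)

Lemma generators_exist B : exists R (v : forall b, 'I_R -> G (initial b)),
  (forall b j, Gf k (initial b) (v b j)) /\
  forall b x, b <= B -> Gf k (initial b) x -> exists2 y,
    gen (fun a => exists j, a = v b j) y & Gf k.+1 (initial b) (gmul (ginv y) x).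
Proof.
pose s b := sval (cid (frG k1 (initial b))).
have sP b := svalP (cid (frG k1 (initial b))).
(* One number of labels for all [b] up to [B]: shorter lists are padded with the identity, and lists
   for larger [b] may be cut. *)
pose R := \max_(b < B.+1) size (s b).
exists R, (fun b j => nth gone (s b) j); split=> [b j|b x bB /(proj2 (sP b))[y gy yx]].
  have [jb|jb] := ltnP j (size (s b)); last first.
    by rewrite nth_default //; case: (Gf_subgroup (initial b) k1).
  apply: (proj1 (sP b)); rewrite -/(s b); elim: (s b) (j : nat) jb => //= a t IH [|i] it.
    by left.
  by right; apply: IH.
exists y => //; apply: gen_min gy => [|a]; first exact: gen_subgroup.
rewrite -/(s b) => ab; apply: gen_base.
suff [i ib ->] : exists2 i, i < size (s b) & a = nth gone (s b) i.
  have iR : i < R by apply: leq_trans ib (leq_bigmax (Ordinal (bB : b < B.+1))).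
  by exists (Ordinal iR).
elim: (s b) ab => //= c t IH [->|/IH[i it ->]]; first by exists 0.
by exists i.+1.
Qed.

(** * The normal closure of the part of bounded degree *)

Section NormalClosure.
Variables (A B N : nat).
Hypotheses (bgG : boundedly_generated_in G A).
Hypothesis bngk : boundedly_normally_generated_in (Gf k) B.
Hypothesis leABN : A + B <= N.

Definition bounded_closure (J : {fset nat}) : G J -> Prop :=
  gen (fun y => exists2 I : {fset nat}, I `<=` J /\ #|` I| <= N &
    exists2 z, sub_at (Gf k.+1) I J z & exists g : G J, y = gconj z g).

Lemma bounded_closure_normal J : is_normal_subgroup (@bounded_closure J).
Proof.
apply: gen_normal => x g [I HI [z zI [h ->]]]; exists I => //; exists z => //.
by exists (gmul h g); rewrite gconjJ.
Qed.

Lemma bounded_closure_base (I J : {fset nat}) z : I `<=` J -> #|` I| <= N ->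
  Gf k.+1 I z -> bounded_closure (Ginc G I J z).
Proof.
move=> IJ cI zI; apply: gen_base; exists I => //.
by exists (Ginc G I J z); [exists z | exists gone; rewrite gconjx1].
Qed.

Lemma bounded_closure_sub J (x : G J) : bounded_closure x -> Gf k.+1 J x.
Proof.
apply: gen_min => [|_ [I [IJ _] [_ [z zI ->] [g ->]]]]; first exact: Gf_subgroup.
by apply: (proj2 (Gf_normal J (ltn0Sn k))); apply: Gf_inc.
Qed.

(** Commutators of generators come from a union of two small subsets; bilinearity modulo the closure
    then extends this to [g], and afterwards to [x]. *)
Lemma bounded_closure_comm J (g x : G J) : Gf k J x -> bounded_closure (gcomm g x).
Proof.
have nD := bounded_closure_normal J.
have comm_base (I I' : {fset nat}) a z : I `<=` J -> I' `<=` J ->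
    #|` I| <= A -> #|` I'| <= B -> Gf k I' z ->
    bounded_closure (gcomm (Ginc G I J a) (Ginc G I' J z)).
  (* [L] has at most [A + B] elements, and over [L] the commutator already lies in [Gf k.+1]. *)
  move=> IJ I'J cI cI' zk; set L := I `|` I'.
  have LJ : L `<=` J by rewrite fsubUset IJ.
  have IL : I `<=` L := fsubsetUl _ _; have I'L : I' `<=` L := fsubsetUr _ _.
  rewrite -(Ginc_trans G _ _ _ IL LJ a) -(Ginc_trans G _ _ _ I'L LJ z) /=.
  rewrite -(hom_comm (Ginc_hom G _ _ LJ)); apply: bounded_closure_base => //.
    apply: leq_trans leABN; apply: leq_trans (leq_add cI cI').
    by rewrite cardfsU leq_subr.
  by apply: Gf_comm; apply: Gf_inc.
have comm_inc h (I' : {fset nat}) z : I' `<=` J -> #|` I'| <= B -> Gf k I' z ->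
    bounded_closure (gcomm h (Ginc G I' J z)).
  (* The commutant lemma is used for a singleton, whence the equation on [y]. *)
  move=> I'J cI' zk; suff: forall y, y = Ginc G I' J z -> bounded_closure (gcomm h y).
    by apply.
  apply: (gen_min (commutant_subgroup nD (eq^~ (Ginc G I' J z)))) (bgG h).
  by move=> _ [I [IJ cI] [a _ ->]] y ->; apply: comm_base.
move=> /bngk gx; apply: (gcomm_sym nD).
pose H (_ : G J) := True.
suff: forall h, H h -> bounded_closure (gcomm x h) by apply.
apply: (gen_min (commutant_subgroup nD H)) gx.
move=> _ [I' [I'J cI'] [_ [z zI ->] [h ->]]] {}g _.
(* The conjugation is shifted to the other entry, which is arbitrary. *)
have -> : gcomm (gconj (Ginc G I' J z) h) g =
    gconj (gcomm (Ginc G I' J z) (gconj g (ginv h))) h.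
  by rewrite /gcomm /gconj !gnorm.
by apply: (proj2 nD); apply: (gcomm_sym nD); apply: comm_inc.
Qed.

End NormalClosure.

(** In the quotient [V] of [Gf k] by the bounded closure, [x] equals a combination [p]. As [x] lies
    in [Gf k.+1], [p] is a relation, so it vanishes in [V] and [x] lies in the closure. *)
Lemma boundedly_normally_generated_succ : boundedly_generated G ->
  boundedly_normally_generated (Gf k) -> boundedly_normally_generated (Gf k.+1).
Proof.
move=> [A bgG] [B bngk]; have [R [v [v_in v_gen]]] := generators_exist B.
have [N0 N0P] := relations_bounded_degree (fun n p => @proj1 _ _)
  (@relation_cat R v v_in B) (@relation_opp R v v_in B) (@relation_push R v B).
(* [A + B] makes the quotient central, and [N0] brings in the relations that control all others. *)
have [N [leABN leN]] : exists N, (A + B <= N)%N /\ N0 <= N.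
  by exists (A + B + N0)%N; rewrite leq_addr leq_addl.
exists N => J x; split; last exact: bounded_closure_sub.
rewrite -/(bounded_closure N x) => xk1; have xk := Gf_succ xk1.
have [|||g y yk|V [f [fD f0 fJ]]] :=
  @central_quotient (G J) (Gf k J) (@bounded_closure N J).
- exact: Gf_subgroup.
- exact: bounded_closure_normal.
- by move=> y /bounded_closure_sub/Gf_succ.
- exact: (bounded_closure_comm bgG bngk leABN).
have [I z IJ cI zI|p hp fp] := monomials_generate v_in v_gen bngk fD fJ _ xk.
  apply/f0; first by apply: Gf_inc => //; apply: Gf_succ.
  apply: bounded_closure_base => //; apply: leq_trans leABN.
  exact: leq_trans cI (leq_addl _ _).
apply/(f0 _ xk); rewrite fp.
(* Relations of degree at most [N0] hold in [V], since their values come from subsets of size at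
   most [N]. *)
apply: (N0P #|` J|) => [m q sm cm [hq qK]|].
  rewrite -(graded_evprod v_in) // -(Ginc_evprod v J hq).
  have zk1 : Gf k.+1 (sub J m) (evprod (monomial_value v (sub J m)) q).
    by apply: qK; rewrite card_sub.
  apply/f0; first by apply: Gf_inc => //; [exact: sub_fsub | exact: Gf_succ].
  apply: bounded_closure_base => //; first exact: sub_fsub.
  by rewrite card_sub // (leq_trans cm).
(* That [p] is a relation is checked on [J] itself, where its value differs from [x] by an element
   of the closure. *)
split=> // J' cJ'; apply: (evprod_transfer v_in (esym cJ')).
have pk := evprod_value_in v_in J p.
have D_p : bounded_closure N (gmul (ginv x) (evprod (monomial_value v J) p)).
  have [_ HM HV] := Gf_subgroup J k1.
  apply/f0; first by apply: HM => //; apply: HV.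
  rewrite fD //; last exact: HV.
  by rewrite (additive_onV (Gf_subgroup J k1) fD) // graded_evprod // fp addNr.
have [_ HM _] := Gf_subgroup J (ltn0Sn k).
by have := HM _ _ xk1 (bounded_closure_sub D_p); rewrite !gnorm.
Qed.

End Graded.
End WeakFIgroups.

(** * Induction along the filtration *)

Theorem theoremG (G : weakFIgroup) (Gf : nat -> FIsubset G) :
  central_filtration Gf -> finite_rank Gf -> boundedly_generated G ->
  forall k, 1 <= k -> boundedly_normally_generated (Gf k).
Proof.
move=> filtG frG bgG; elim=> // -[_ _|k IH _]; last first.
  by apply: boundedly_normally_generated_succ => //; apply: IH.
(* For [k = 1] the subgroup is all of [G], so the degree [A] of generation works, with trivial
   conjugators. *)
have [_ G1 _ _] := filtG; have [A gA] := bgG; exists A => J x; split=> // _.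
apply: gen_min (gA J x); first exact: gen_subgroup.
move=> _ [I HI [a _ ->]]; apply: gen_base; exists I => //.
by exists (Ginc G I J a); [exists a | exists gone; rewrite gconjx1].
Qed.
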